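(* Let $(X,r)$ be a solution whose permutation left brace $B=\mathcal{G}(X,r)$ is finite. Then the Dehornoy's class $d$ of $(X,r)$ is equal to the exponent $\exp(B,+)$ of the additive group of $B$. In particular, $d$ divides $|B|$.
   Context: A solution is a pair $(X,r)$ with $X$ a non-empty set and $r:X\times X\to X\times X$, $r(x,y)=(\sigma_x(y),\tau_y(x))$, such that $(r\times \mathrm{id})(\mathrm{id}\times r)(r\times \mathrm{id})=(\mathrm{id}\times r)(r\times \mathrm{id})(\mathrm{id}\times r)$ on $X^3$, $r^2=\mathrm{id}$ (involutive), and all maps $\sigma_x,\tau_y:X\to X$ are bijections (non-degenerate). The permutation group $\mathcal{G}(X,r)$ is the subgroup of $\mathrm{Sym}(X)$ generated by all $\sigma_x$. A left brace is a set $B$ with two operations $+,\circ$ such that $(B,+)$ is an abelian group, $(B,\circ)$ is a group and $a\circ(b+c)=a\circ b-a+a\circ c$ for all $a,b,c$. Put $\lambda_a(b)=-a+a\circ b$. The permutation left brace of $(X,r)$ is $\mathcal{G}(X,r)$ with $\circ$ equal to composition and with the unique addition making it a left brace such that $\lambda_g(\sigma_x)=\sigma_{g(x)}$ for all $g\in\mathcal{G}(X,r)$, $x\in X$. Dehornoy's class: set $x\cdot y=\sigma_x^{-1}(y)$ and define $\Omega_n:X^n\to X$ by $\Omega_1(x_1)=x_1$ and $\Omega_n(x_1,\dots,x_n)=\Omega_{n-1}(x_1,\dots,x_{n-1})\cdot\Omega_{n-1}(x_1,\dots,x_{n-2},x_n)$ for $n>1$. The Dehornoy's class of $(X,r)$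 is the minimal positive integer $d$ such that $\Omega_{d+1}(x,x,\dots,x,y)=y$ for all $x,y\in X$. The exponent of a finite group is the least common multiple of the orders of its elements. *)

(* Defs.v *)
From HB Require Import structures.
From mathcomp Require Import all_boot ssralg.
From mathcomp Require Import finmap boolp classical_sets functions cardinality.
From mathcomp Require Import fsbigop.

Set Implicit Arguments.
Unset Strict Implicit.
Unset Printing Implicit Defensive.

Local Open Scope classical_set_scope.

Record sym (X : Type) := Sym { sym_fun :> X -> X; sym_bij : bijective sym_fun }.

HB.instance Definition _ (X : Type) := gen_eqMixin (sym X).
HB.instance Definition _ (X : Type) := gen_choiceMixin (sym X).

Lemma sym_ext (X : Type) (f g : sym X) : (forall x, f x = g x) -> f = g.
Proof.
case: f g => [f fb] [g gb] /= /funext fg; case: _ / fg in gb *.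
by congr Sym; exact: Prop_irrelevance.
Qed.

Section SymGroup.
Variable X : Type.

Definition sym_one : sym X := @Sym X id (@Bijective _ _ id id (fun=> erefl) (fun=> erefl)).

Definition sym_mul (f g : sym X) : sym X :=
  @Sym X (fun x => f (g x)) (bij_comp (sym_bij f) (sym_bij g)).

Lemma sym_inv_ex (f : sym X) : exists g : sym X, @cancel X X f g /\ @cancel X X g f.
Proof. by case: (sym_bij f) => g fK gK; exists (@Sym X g (@Bijective _ _ g f gK fK)). Qed.

Definition sym_inv (f : sym X) : sym X := projT1 (cid (sym_inv_ex f)).

Lemma sym_invK (f : sym X) : @cancel X X f (sym_inv f).
Proof. by rewrite /sym_inv; case: cid => g []. Qed.

Lemma sym_Kinv (f : sym X) : @cancel X X (sym_inv f) f.
Proof. by rewrite /sym_inv; case: cid => g []. Qed.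

Lemma sym_mulA : associative sym_mul. Proof. by move=> f g h; exact: sym_ext. Qed.
Lemma sym_mul1 : left_id sym_one sym_mul. Proof. by move=> f; exact: sym_ext. Qed.
Lemma sym_mulr1 : right_id sym_one sym_mul. Proof. by move=> f; exact: sym_ext. Qed.
Lemma sym_mulV : left_inverse sym_one sym_inv sym_mul.
Proof. by move=> f; apply: sym_ext => x /=; rewrite sym_invK. Qed.
Lemma sym_mulrV : right_inverse sym_one sym_inv sym_mul.
Proof. by move=> f; apply: sym_ext => x /=; rewrite sym_Kinv. Qed.

HB.instance Definition _ :=
  isGroup.Build (sym X) sym_mulA sym_mul1 sym_mulr1 sym_mulV sym_mulrV.

End SymGroup.

Definition is_subgroup (G : groupType) (H : set G) : Prop :=
  [/\ H 1%g, forall a b, H a -> H b -> H (a * b)%g & forall a, H a -> H a^-1%g].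

Definition r12 (X : Type) (r : X * X -> X * X) (t : X * X * X) : X * X * X :=
  let: (x, y, z) := t in let: (x', y') := r (x, y) in (x', y', z).

Definition r23 (X : Type) (r : X * X -> X * X) (t : X * X * X) : X * X * X :=
  let: (x, y, z) := t in let: (y', z') := r (y, z) in (x, y', z').

Record solution (X : Type) := Solution {
  sol_map : X * X -> X * X;
  sol_inhabited : inhabited X;
  sol_braid : forall t, r12 sol_map (r23 sol_map (r12 sol_map t))
                      = r23 sol_map (r12 sol_map (r23 sol_map t));
  sol_involutive : involutive sol_map;
  sol_sigma_bij : forall x, bijective (fun y => (sol_map (x, y)).1);
  sol_tau_bij : forall y, bijective (fun x => (sol_map (x, y)).2)
}.

Definition sigma (X : Type) (s : solution X) (x : X) : sym X :=
  Sym (sol_sigma_bij s x).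

Definition tau (X : Type) (s : solution X) (y : X) : sym X :=
  Sym (sol_tau_bij s y).

Definition permutation_set (X : Type) (s : solution X) : set (sym X) :=
  smallest (@is_subgroup (sym X)) (range (sigma s)).

Lemma permutation_set_subgroup (X : Type) (s : solution X) :
  is_subgroup (permutation_set s).
Proof.
split=> [A [[]] //|a b Pa Pb A AP|a Pa A AP].
  by have [[_ AM _] _] := AP; apply: AM; [exact: Pa|exact: Pb].
by have [[_ _ AV] _] := AP; apply: AV; exact: Pa.
Qed.

Definition permutation_group (X : Type) (s : solution X) : Type :=
  {g : sym X | g \in permutation_set s}.

HB.instance Definition _ (X : Type) (s : solution X) :=
  SubChoice.on (permutation_group s).

Lemma permutation_group_closed (X : Type) (s : solution X) :
  group_closed (fun g : sym X => g \in permutation_set s).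
Proof.
have [P1 PM PV] := permutation_set_subgroup s.
split=> [|a b Pa Pb]; first exact: (mem_set P1).
apply: (mem_set (A := permutation_set s)); apply: PM; first exact: (set_mem Pa).
exact: PV (set_mem Pb).
Qed.

HB.instance Definition _ (X : Type) (s : solution X) :=
  SubChoice_isSubGroup.Build (sym X) _ (permutation_group s)
    (permutation_group_closed s).

Definition permutation_fun (X : Type) (s : solution X)
  (g : permutation_group s) : X -> X := val g.
Coercion permutation_fun : permutation_group >-> Funclass.

Lemma sigma_in (X : Type) (s : solution X) (x : X) :
  sigma s x \in permutation_set s.
Proof. by rewrite inE; apply: sub_gen_smallest; exists x. Qed.

Definition psigma (X : Type) (s : solution X) (x : X) : permutation_group s :=
  exist _ (sigma s x) (sigma_in s x).

(* A left brace whose multiplicative group (B, o) is the given group B, so    *)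
(* that a * b stands for a o b.                                               *)

Record left_brace (B : groupType) := LeftBrace {
  brace_add : B -> B -> B;
  brace_zero : B;
  brace_opp : B -> B;
  brace_addA : associative brace_add;
  brace_addC : commutative brace_add;
  brace_add0 : left_id brace_zero brace_add;
  brace_addN : left_inverse brace_zero brace_opp brace_add;
  brace_distr : forall a b c : B,
    (a * brace_add b c)%g
    = brace_add (brace_add (a * b)%g (brace_opp a)) (a * c)%g
}.

Lemma left_brace_ext (B : groupType) (L M : left_brace B) :
  brace_add L =2 brace_add M -> L = M.
Proof.
move=> LM; have {LM} : brace_add L = brace_add M.
  by apply/funext => a; apply/funext => b; exact: LM.
case: L M => [p z n pA pC p0 pN pD] [q y m qA qC q0 qN qD] /= pq.
case: _ / pq in qA qC q0 qN qD *.
have zy : z = y by rewrite -(q0 z) pC p0.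
case: _ / zy in q0 qN *.
have nm : n = m.
  apply/funext => a.
  by rewrite -(p0 (n a)) -(qN a) -pA (pC a) pN pC p0.
case: _ / nm in qN qD *.
by congr LeftBrace; exact: Prop_irrelevance.
Qed.

Definition additive_group (B : groupType) (L : left_brace B) : Type := B.

HB.instance Definition _ (B : groupType) (L : left_brace B) :=
  Choice.on (additive_group L).
HB.instance Definition _ (B : groupType) (L : left_brace B) :=
  GRing.isZmodule.Build (additive_group L)
    (brace_addA L) (brace_addC L) (brace_add0 L) (brace_addN L).

Definition brace_lambda (B : groupType) (L : left_brace B) (a b : B) : B :=
  brace_add L (brace_opp L a) (a * b)%g.

Definition is_permutation_brace (X : Type) (s : solution X)
    (L : left_brace (permutation_group s)) : Prop :=
  forall (g : permutation_group s) (x : X),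
    brace_lambda L g (psigma s x) = psigma s (g x).

(* Existence and uniqueness of the permutation left brace. For g in G(X,r)    *)
(* and a signed letter a = (e, x), step g a is the brace sum g + e sigma_x;   *)
(* the steps commute, and every element of G(X,r) is reached from 1.          *)

Section PermutationBrace.
Variables (X : Type) (s : solution X).

Local Notation G := (permutation_group s).
Local Notation sg := (psigma s).
Local Open Scope group_scope.

Lemma perm_eq (g h : G) : (forall x, g x = h x) -> g = h.
Proof. by move=> gh; apply/val_inj/sym_ext. Qed.

Lemma perm_mulE (g h : G) x : (g * h : G) x = g (h x). Proof. by []. Qed.
Lemma perm_oneE x : (1 : G) x = x. Proof. by []. Qed.
Lemma perm_invK (g : G) : @cancel X X g (g^-1%g : G).
Proof. by move=> x; rewrite -perm_mulE mulVg. Qed.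
Lemma perm_Kinv (g : G) : @cancel X X (g^-1%g : G) g.
Proof. by move=> x; rewrite -perm_mulE mulgV. Qed.

Lemma perm_group_ind (P : G -> Prop) :
    P 1 -> (forall g x, P g -> P (g * sg x)) ->
    (forall g x, P g -> P (g * (sg x)^-1)) ->
  forall g, P g.
Proof.
move=> P1 PM PV g.
pose H := [set h : sym X | exists k : G, val k = h /\
             forall g, P g -> P (g * k) /\ P (g * k^-1)].
have [k [kg kP]] : H (val g).
  have := valP g; rewrite inE /=; apply: smallest_sub.
    split.
    - by exists 1; split=> // h Ph; rewrite invg1 mulg1.
    - move=> _ _ [a [<- aP]] [b [<- bP]]; exists (a * b); split=> // h Ph.
      rewrite invgM !mulgA; split.
        by have [/bP[]] := aP _ Ph.
      by have [_ /aP[]] := bP _ Ph.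
    - move=> _ [a [<- aP]]; exists a^-1; split=> // h Ph.
      by rewrite invgK; have [] := aP _ Ph.
  by move=> _ [x _ <-]; exists (sg x); split=> // h Ph; split; [exact: PM|exact: PV].
have -> : g = k by exact: val_inj.
by have [] := kP _ P1; rewrite mul1g.
Qed.

Lemma sigma_tau x y : sigma s (sigma s x y) (tau s y x) = x.
Proof.
have := sol_involutive s (x, y).
by case E : (sol_map s (x, y)) => [u v] /= /(congr1 fst) /=; rewrite E.
Qed.

Lemma tau_sigma x y : tau s (tau s y x) (sigma s x y) = y.
Proof.
have := sol_involutive s (x, y).
by case E : (sol_map s (x, y)) => [u v] /= /(congr1 snd) /=; rewrite E.
Qed.

Lemma sigma_braid x y z :
  sigma s (sigma s x y) (sigma s (tau s y x) z) = sigma s x (sigma s y z).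
Proof.
have /(congr1 (fun t => t.1.1)) := sol_braid s (x, y, z).
rewrite /sigma /tau /=.
case E1 : (sol_map s (x, y)) => [a b] /=.
case E2 : (sol_map s (b, z)) => [c d] /=.
case E3 : (sol_map s (a, c)) => [e f] /=.
case E4 : (sol_map s (y, z)) => [g h] /=.
case E5 : (sol_map s (x, g)) => [i j] /=.
by case: (sol_map s (j, h)) => [k l] /=.
Qed.

Lemma sg_mul x y : sg x * sg y = sg (sg x y) * sg (((sg (sg x y))^-1 : G) x).
Proof.
have -> : ((sg (sg x y))^-1 : G) x = tau s y x.
  by apply: (can_inj (perm_invK (sg (sg x y)))); rewrite perm_Kinv; exact/esym/sigma_tau.
by apply: perm_eq => z; exact/esym/sigma_braid.
Qed.

(* T^-1, for the bijection T x = sigma_x^-1 (x)                               *)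
Definition invT (x : X) : X := sym_inv (tau s x) x.

Lemma sg_invT x : sg (invT x) x = invT x.
Proof.
have tz : tau s x (invT x) = x by exact: sym_Kinv.
apply: (can_inj (sym_invK (tau s x))).
by have := tau_sigma (invT x) x; rewrite tz => ->.
Qed.

Lemma invT_unique x y : sg y x = y -> invT x = y.
Proof.
move=> yx; have ty : tau s x y = x.
  apply: (can_inj (perm_invK (sg y))); rewrite yx.
  by have := sigma_tau y x; rewrite [sigma s y x]yx.
by apply: (can_inj (sym_invK (tau s x))); rewrite ty; exact: sym_Kinv.
Qed.

Definition letter := (bool * X)%type.

Definition rho (a : letter) : G := if a.1 then sg a.2 else (sg (invT a.2))^-1.

Definition act (g : G) (a : letter) : letter := (a.1, g a.2).

Definition step (g : G) (a : letter) : G := g * rho (act g^-1 a).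

Lemma actM g h a : act (g * h) a = act g (act h a). Proof. by []. Qed.
Lemma act1 a : act 1 a = a. Proof. by case: a. Qed.
Lemma actK g : cancel (act g) (act g^-1).
Proof. by move=> a; rewrite -actM mulVg act1. Qed.

Lemma stepM g h a : step (g * h) (act g a) = g * step h a.
Proof. by rewrite /step invgM actM actK mulgA. Qed.

Lemma rho_mixed x y : step (rho (true, x)) (false, y) = step (rho (false, y)) (true, x).
Proof.
rewrite /step /rho /act /= invgK.
set z := invT y.
set u := ((sg (sg z x))^-1 : G) z.
have e : sg z * sg x = sg (sg z x) * sg u := sg_mul z x.
have -> : invT (((sg x)^-1 : G) y) = u.
  apply: invT_unique; apply: (can_inj (perm_invK (sg (sg z x)))).
  rewrite -perm_mulE -e perm_mulE perm_Kinv [RHS]perm_Kinv.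
  exact: sg_invT.
apply: (mulgI (sg z)); rewrite mulgA e mulgK.
by rewrite mulgA mulgV mul1g.
Qed.

Lemma step_rho a b : step (rho a) b = step (rho b) a.
Proof.
case: a b => [[] x] [[] y]; [|exact: rho_mixed|exact/esym/rho_mixed|].
  have := sg_mul x (((sg x)^-1 : G) y); rewrite perm_Kinv; exact.
rewrite /step /rho /act /= !invgK.
set p := invT x; set q := invT y; set u := invT (sg p y).
have e : sg u * sg p = sg (sg u p) * sg q.
  have := rho_mixed p (sg p y); rewrite /step /rho /act /= invgK perm_invK.
  by rewrite -/q -/u => /(congr1 (fun g => sg u * g * sg q)); rewrite !mulgA mulgVK mulgV mul1g.
have -> : invT (sg q x) = sg u p.
  by apply: invT_unique; rewrite -perm_mulE -e perm_mulE sg_invT.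
by rewrite -!invgM e.
Qed.

Lemma stepC g a b : step (step g a) b = step (step g b) a.
Proof.
have E c d : step (step g c) d = g * step (rho (act g^-1 c)) (act g^-1 d).
  rewrite -stepM -actM mulgV act1.
  by rewrite /step.
by rewrite !E step_rho.
Qed.

Definition steps (g : G) (w : seq letter) : G := foldl step g w.

Lemma steps_cat g v w : steps g (v ++ w) = steps (steps g v) w.
Proof. exact: foldl_cat. Qed.

Lemma steps_step g w a : steps (step g a) w = step (steps g w) a.
Proof. by elim: w g => //= b w IH g; rewrite stepC IH. Qed.

Lemma steps_catC g v w : steps g (v ++ w) = steps g (w ++ v).
Proof.
elim: v g => [|a v IH] g; first by rewrite cats0.
by rewrite [LHS]/= IH -[a :: v]cat1s !steps_cat /= -steps_step.
Qed.

Lemma steps_map g h w : steps (g * h) (map (act g) w) = g * steps h w.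
Proof. by elim: w h => //= a w IH h; rewrite stepM IH. Qed.

Lemma step_sg g x : step g (true, g x) = g * sg x.
Proof. by rewrite /step /rho /act /= perm_invK. Qed.

Lemma step_neg g a : step (step g a) (~~ a.1, a.2) = g.
Proof.
have E x : rho (true, x) * rho (false, ((sg x)^-1 : G) x) = 1.
  by rewrite /rho /= (@invT_unique _ x) ?mulgV // perm_Kinv.
have E' x : rho (false, x) * rho (true, ((rho (false, x))^-1 : G) x) = 1.
  by rewrite /rho /= invgK sg_invT mulVg.
rewrite {1}/step /act invgM /= perm_mulE {1}/step -mulgA.
case: a => [[] x] /=; rewrite /act /=.
  by rewrite [X in g * X]E mulg1.
by rewrite [X in g * X]E' mulg1.
Qed.

Lemma steps_surj g : exists w, steps 1 w = g.
Proof.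
elim/perm_group_ind: g => [|g x [w <-]|g x [w <-]]; first by exists [::].
  by exists (rcons w (true, (steps 1 w) x)); rewrite /steps foldl_rcons step_sg.
exists (rcons w (false, (steps 1 w) (((sg x)^-1 : G) x))).
rewrite /steps foldl_rcons {1}/step /rho /act /= perm_invK.
by rewrite (@invT_unique _ x) // perm_Kinv.
Qed.

Definition word (g : G) : seq letter := projT1 (cid (steps_surj g)).

Lemma wordK g : steps 1 (word g) = g.
Proof. by rewrite /word; case: cid. Qed.

Definition padd (g h : G) : G := steps g (word h).

Lemma padd_steps g w : padd g (steps 1 w) = steps g w.
Proof.
rewrite /padd -{1 2}(wordK g) -!steps_cat ![_ (word g ++ _)]steps_catC !steps_cat.
by rewrite wordK.
Qed.

Lemma paddA : associative padd.
Proof.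
move=> a b c; rewrite -(wordK b) -(wordK c) [padd (steps 1 (word b)) _]padd_steps.
by rewrite -steps_cat !padd_steps steps_cat.
Qed.

Lemma paddC : commutative padd.
Proof.
by move=> a b; rewrite -(wordK b) -(wordK a) !padd_steps -!steps_cat steps_catC.
Qed.

Lemma padd0 : left_id 1 padd. Proof. by move=> a; rewrite /padd wordK. Qed.

Definition popp (g : G) : G := steps 1 [seq (~~ a.1, a.2) | a : letter <- word g].

Lemma paddN : left_inverse 1 popp padd.
Proof.
move=> g; rewrite paddC -{1}(wordK g) /popp padd_steps.
elim: (word g) => [|a w IH] //=.
by rewrite (steps_step 1 w a) step_neg.
Qed.

Lemma padd_mul g h : padd g (steps 1 (map (act g) (word h))) = g * h.
Proof. by rewrite padd_steps -{1}[g]mulg1 steps_map wordK. Qed.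

Lemma padd_distr a b c : a * padd b c = padd (padd (a * b) (popp a)) (a * c).
Proof.
have -> : padd b c = steps 1 (word b ++ word c) by rewrite steps_cat wordK.
rewrite -steps_map mulg1 map_cat steps_cat.
rewrite -[in RHS](padd_mul a b) -[in RHS](padd_mul a c).
by rewrite -(paddA _ (popp a)) (paddA (popp a)) paddN padd0 !padd_steps.
Qed.

Lemma permutation_brace_unique_existence :
  exists! L : left_brace G, is_permutation_brace L.
Proof.
exists (LeftBrace paddA paddC padd0 paddN padd_distr); split.
  move=> g x; rewrite /brace_lambda /=.
  have <- : padd g (sg (g x)) = g * sg x.
    have -> : sg (g x) = steps 1 [:: (true, g x)].
      by rewrite /= /step /rho /act /= invg1 mul1g.
    by rewrite padd_steps /= step_sg.
  by rewrite paddA paddN padd0.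
move=> L LP; apply: left_brace_ext => g h /=.
have addK a b : brace_add L a (brace_add L (brace_opp L a) b) = b.
  by rewrite brace_addA (brace_addC _ a) brace_addN brace_add0.
have addS a x : brace_add L a (sg x) = step a (true, x).
  by rewrite -{1}(perm_Kinv a x) -LP addK /step.
have addSt a b c : brace_add L a (step b c) = step (brace_add L a b) c.
  case: c => [[] x]; first by rewrite -!addS brace_addA.
  set y := step b _.
  have <- : step y (true, x) = b by exact: (step_neg b (false, x)).
  by rewrite -addS brace_addA addS (step_neg _ (true, x)).
have g1 : brace_add L g 1 = g.
  have -> : (1 : G) = brace_zero L; last by rewrite brace_addC brace_add0.
  have := brace_distr L 1 1 (brace_zero L); rewrite !mul1g.
  by rewrite (brace_addC L 1 (brace_zero L)) brace_add0 (brace_addC L 1)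
             brace_addN brace_add0.
rewrite -(wordK h) padd_steps -{1}g1.
elim: (word h) (1 : G) => //= a w IH b.
by rewrite -addSt IH.
Qed.

End PermutationBrace.

Definition permutation_brace (X : Type) (s : solution X) :
    left_brace (permutation_group s) :=
  projT1 (cid (permutation_brace_unique_existence s)).

Lemma permutation_braceP (X : Type) (s : solution X) :
  is_permutation_brace (permutation_brace s).
Proof. by rewrite /permutation_brace; case: cid => L []. Qed.

Definition dot (X : Type) (s : solution X) (x y : X) : X :=
  ((sigma s x)^-1%g : sym X) y.

(* Omega_rev s [:: x_(n-1); ...; x_1] x_n = Omega_n (x_1, ..., x_n)           *)
Fixpoint Omega_rev (X : Type) (s : solution X) (u : seq X) (y : X) : X :=
  if u is x :: u' then dot s (Omega_rev s u' x) (Omega_rev s u' y) else y.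

Definition Omega (X : Type) (s : solution X) (n : nat) (t : n.+1.-tuple X) : X :=
  Omega_rev s (rev (belast (thead t) (behead t))) (last (thead t) (behead t)).

Lemma Omega_rcons (X : Type) (s : solution X) (n : nat) (u : n.-tuple X) (y : X) :
  Omega s [tuple of rcons u y] = Omega_rev s (rev u) y.
Proof.
rewrite /Omega; have -> : thead [tuple of rcons u y] = head y u.
  by rewrite /thead (tnth_nth y) /=; case: (tval u).
by rewrite /=; case: (tval u) => //= x v; rewrite belast_rcons last_rcons.
Qed.

Lemma Omega_1 (X : Type) (s : solution X) (x : X) : Omega s [tuple x] = x.
Proof. by []. Qed.

Lemma Omega_S (X : Type) (s : solution X) (n : nat) (u : n.-tuple X) (x y : X) :
  Omega s [tuple of rcons (rcons u x) y]
  = dot s (Omega s [tuple of rcons u x]) (Omega s [tuple of rcons u y]).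
Proof. by rewrite !Omega_rcons /= rev_rcons. Qed.

Definition Dehornoy_identity (X : Type) (s : solution X) (d : nat) : Prop :=
  forall x y : X, Omega s [tuple of rcons (nseq d x) y] = y.

Definition is_Dehornoy_class (X : Type) (s : solution X) (d : nat) : Prop :=
  [/\ 0 < d, Dehornoy_identity s d
    & forall m, 0 < m -> Dehornoy_identity s m -> d <= m].

(* Exponent of a finite additive group. Junk values: the order is 0 for an    *)
(* element of infinite order, and the exponent is 1 if infinitely many        *)
(* elements are nonzero.                                                      *)

Definition add_order (V : zmodType) (a : V) : nat :=
  if pselect (exists n, (0 < n) && (a *+ n == 0)%R) is left h then ex_minn h else 0.

Definition add_exponent (V : zmodType) : nat :=
  \big[lcmn/1]_(a \in [set: V]) add_order a.

(* Main.v *)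
Require Import Defs.
From mathcomp Require Import all_boot ssralg.
From mathcomp Require Import finmap boolp classical_sets cardinality.
From mathcomp Require Import fsbigop.

(** Write [B] for the permutation brace of [(X, r)]. The brace addition of a
    generator is [g + sigma_x = g o sigma_(g^-1 x)], because
    [lambda_g (sigma_y) = sigma_(g y)]. Hence the permutation [n sigma_x]
    (an additive multiple) satisfies the recursion
    [(n + 1) sigma_x = (n sigma_x) o sigma_((n sigma_x)^-1 x)], and this is the
    recursion that defines [Omega]: by induction,
    [Omega_(n+1) (x, ..., x, y) = (n sigma_x)^-1 y] ([Omega_nseq]).

    The zero of [B] is the identity permutation, so the Dehornoy identity for
    [d] says that [d] kills every [sigma_x]. The [sigma_x] generate [(B, o)],
    and multiplying on the right by a [sigma_x] or its inverse amounts to adding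
    or subtracting some [sigma_y]; so they also generate [(B, +)], and the
    Dehornoy identity for [d] holds exactly when [d] kills the whole of
    [(B, +)] ([Dehornoy_identityP]). For finite [B] this means that the
    exponent divides [d], so the exponent is the least such positive integer.
    It divides [|B|] because [|B|] kills [(B, +)] ([mulrn_card]). *)

Import GRing.Theory.

Set Implicit Arguments.
Unset Strict Implicit.
Unset Printing Implicit Defensive.

Section AdditiveExponent.
Local Open Scope ring_scope.
Variable V : zmodType.
Implicit Types (a : V) (n : nat).

(** This also covers elements of infinite order: their order is the junk value
    [0], which divides only [0]. *)
Lemma add_order_dvd a n : (add_order a %| n)%N = (a *+ n == 0).
Proof.
rewrite /add_order; case: pselect => [h|h]; last first.
  rewrite dvd0n; have [->|n_gt0] := posnP n; first by rewrite mulr0n !eqxx.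
  by apply/esym/negP => an0; apply: h; exists n; rewrite n_gt0.
case: ex_minnP => m /andP[m_gt0 /eqP am0] m_min.
rewrite {2}(divn_eq n m) mulrnDr mulnC mulrnA am0 mul0rn add0r /dvdn.
apply/eqP/eqP => [->|ar0]; first by rewrite mulr0n.
apply/eqP; rewrite -leqn0 leqNgt; apply/negP => r_gt0.
have := m_min (n %% m)%N; rewrite r_gt0 ar0 eqxx => /(_ isT).
by rewrite leqNgt ltn_mod m_gt0.
Qed.

Lemma biglcmn_dvd_seq (T : eqType) (r : seq T) (F : T -> nat) n :
  (\big[lcmn/1%N]_(i <- r) F i %| n)%N = all (fun i => F i %| n)%N r.
Proof. by elim: r => [|i r IH]; rewrite ?big_nil ?dvd1n // big_cons dvdn_lcm IH. Qed.

Hypothesis finV : finite_set [set: V]%classic.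

Lemma add_exponent_dvdP n :
  reflect (forall a, a *+ n = 0) (add_exponent V %| n)%N.
Proof.
rewrite /add_exponent fsbig_finite // biglcmn_dvd_seq.
apply: (iffP allP) => [nP a|nP a _]; last by rewrite add_order_dvd nP.
by apply/eqP; rewrite -add_order_dvd; apply: nP; rewrite in_fset_set // in_setT.
Qed.

(** Translation by [a] permutes [V], so the sum of all elements of [V] is
    unchanged when [a] is added to each of its [|V|] terms. *)
Lemma mulrn_card a : a *+ #|` fset_set [set: V]%classic|%fset = 0.
Proof.
set r := fset_set _.
have mem_r b : b \in r by rewrite in_fset_set // in_setT.
have r_perm : perm_eq [seq b + a | b <- r] r.
  apply: uniq_perm; rewrite ?map_inj_uniq ?fset_uniq //; first exact: addIr.
  move=> b; rewrite [RHS]mem_r; apply/mapP.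
  by exists (b - a); [exact: mem_r | rewrite subrK].
have := perm_big (op := +%R) (x := 0) _ r_perm (P := xpredT) (F := id).
rewrite big_map big_split /= big_const_seq count_predT iter_addr_0.
by rewrite -[RHS]addr0 => /addrI.
Qed.

Lemma add_exponent_gt0 : (0 < add_exponent V)%N.
Proof.
apply: (@dvdn_gt0 _ #|` fset_set [set: V]%classic|%fset).
  rewrite cardfs_gt0; apply/fset0Pn; exists (0 : V).
  by rewrite in_fset_set // in_setT.
by apply/add_exponent_dvdP => a; exact: mulrn_card.
Qed.

End AdditiveExponent.

Section PermutationBrace.
Local Open Scope ring_scope.
Variables (X : Type) (s : solution X).

Local Notation G := (permutation_group s).
Local Notation B := (additive_group (permutation_brace s)).
Local Notation sg := (psigma s).
Local Notation gen x := (sg x : B).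

(** Distributivity at [a = b = 1], [c = 0] reads [1 + 0 = 1 - 1 + 0]. *)
Lemma brace_zeroE : (0 : B) = (1%g : G).
Proof.
pose u : B := (1%g : G).
have := brace_distr (permutation_brace s) 1%g 1%g (0 : B).
rewrite !mul1g => e; have {e} : u + 0 = u - u + 0 by exact: e.
by rewrite addr0 subrr add0r => <-.
Qed.

Lemma mul_sigma (g : G) x : (g * sg x)%g = (g : B) + gen (g x) :> B.
Proof.
rewrite -(permutation_braceP g x).
pose gx : B := (g * sg x)%g.
have -> : brace_lambda (permutation_brace s) g (sg x) = - (g : B) + gx by [].
by rewrite addrA subrr add0r.
Qed.

Lemma add_sigma (g : G) x : (g : B) + gen x = (g * sg ((g^-1%g : G) x))%g :> B.
Proof. by rewrite mul_sigma perm_Kinv. Qed.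

(** The recursion [(n + 1) sigma_x = (n sigma_x) o sigma_((n sigma_x)^-1 x)],
    read on inverses, is the recursion defining [Omega] on [x, ..., x]. *)
Lemma Omega_nseq n x y :
  Omega s [tuple of rcons (nseq n x) y] = ((gen x *+ n : G)^-1%g : G) y.
Proof.
elim: n y => [|n IH] y; first by rewrite Omega_rcons mulr0n brace_zeroE invg1.
have OmegaE z : Omega_rev s (nseq n x) z = ((gen x *+ n : G)^-1%g : G) z.
  by rewrite -IH (Omega_rcons s (nseq_tuple n x)) rev_nseq.
rewrite (Omega_rcons s (nseq_tuple n.+1 x)) rev_nseq /= !OmegaE.
by rewrite mulrSr add_sigma invgM perm_mulE.
Qed.

(** The elements killed by [d] form a subgroup of [(B, +)], and
    right multiplication by [sigma_x] or its inverse adds or subtracts a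
    generator. *)
Lemma mulrn_eq0_of_gen d :
  (forall x, gen x *+ d = 0) -> forall a : B, a *+ d = 0.
Proof.
move=> gen0; elim/perm_group_ind => [|g x g0|g x g0].
- by rewrite -brace_zeroE mul0rn.
- by rewrite mul_sigma mulrnDl (g0 : (g : B) *+ d = 0) gen0 addr0.
set h : G := (g * (sg x)^-1)%g.
have : (g : B) = (h : B) + gen (h x) by rewrite -mul_sigma /h mulgVK.
by move/(congr1 (fun a : B => a *+ d)); rewrite mulrnDl gen0 addr0 g0.
Qed.

Lemma Dehornoy_identityP d :
  Dehornoy_identity s d <-> (forall a : B, a *+ d = 0).
Proof.
split=> [D|kill x y]; last by rewrite Omega_nseq kill brace_zeroE invg1.
apply: mulrn_eq0_of_gen => x; rewrite brace_zeroE.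
apply: (@invg_inj G); rewrite invg1.
by apply: Defs.perm_eq => y; rewrite -Omega_nseq D.
Qed.

End PermutationBrace.

Theorem corollary5p4 (X : Type) (s : solution X)
    (finB : finite_set [set: permutation_group s]%classic) :
  exists d : nat,
    [/\ is_Dehornoy_class s d,
        d = add_exponent (additive_group (permutation_brace s))
      & d %| #|` fset_set [set: permutation_group s]%classic|%fset].
Proof.
pose B : zmodType := additive_group (permutation_brace s).
have finV : finite_set [set: B]%classic := finB.
exists (add_exponent B); split=> //; last first.
  by apply/(add_exponent_dvdP finV) => a; exact: (mulrn_card finV).
split=> [||m m_gt0 /Dehornoy_identityP kill]; first exact: add_exponent_gt0.
  by apply/Dehornoy_identityP/(add_exponent_dvdP finV).
by apply: dvdn_leq => //; apply/(add_exponent_dvdP finV).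
Qed.
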